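(* There is a seeded aTAM system at temperature $2$ which strictly self-assembles the discrete self-similar fractal $K^\infty$ (the ''Sierpinski Cacarpet''), i.e. every terminal production of this system has domain exactly $K^\infty$.
   Context: Directions: $N=(0,1)$, $E=(1,0)$, $S=(0,-1)$, $W=(-1,0)$. aTAM: a tile type is a map $t:\{N,E,S,W\}\to\Sigma$ ($t(d)$ is the glue on side $d$). A seeded Tile Assembly System consists of a finite set of tile types, a strength function $\mathrm{str}:\Sigma\to\mathbb{Z}$, a temperature $\tau\in\mathbb{N}$ and a seed assembly. An assembly is a partial map $A:\mathbb{Z}^2\rightharpoonup T$. For adjacent positions $z,z+d$ in $\mathrm{dom}(A)$, the binding strength of the edge between them is $\mathrm{str}(g)$ if $A(z)(d)=A(z+d)(-d)=g$, and $0$ otherwise. $A$ is stable if every cut of the grid graph on $\mathrm{dom}(A)$ (partition of $\mathrm{dom}(A)$ into two nonempty parts) has total binding strength at least $\tau$. An attachment adds one tile at a position not in $\mathrm{dom}(A)$ such that the resulting assembly is stable. A production is an assembly obtained from the seed by a finite or infinite sequence of attachments (taking the union in the infinite case); it is terminal if no attachment is possible. The system strictly self-assembles $X\subseteq\mathbb{Z}^2$ if every terminal production has domain exactly $X$. Substitutions: for a finite $G\subset\mathbb{N}^2$ with $(0,0)\in G$, let $w=1+\max\{x:(x,y)\in G\}$, $h=1+\max\{y:(x,y)\in G\}$, and for $p=(x,y)$ let $\lfloor p/G\rfloor=(\lfloor x/w\rfloor,\lfloor y/h\rfloor)$ and $p\bmod G=(x\bmod w,y\bmod h)$. Define $\sigma_G(X)=\{p\in\mathbb{N}^2:\lfloor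 p/G\rfloor\in X,\ p\bmod G\in G\}$, $G^k=\sigma_G^k(\{(0,0)\})$, $G^\infty=\bigcup_{k}G^k$. Here $K=\{0,\dots,5\}^2\setminus\{2,3\}^2$. *)

(* Defs.v *)
From Stdlib Require Import ZArith List Arith.
Import ListNotations.
Open Scope Z_scope.

Inductive dir := N | E | S | W.

Definition dvec (d : dir) : Z * Z :=
  match d with N => (0, 1) | E => (1, 0) | S => (0, -1) | W => (-1, 0) end.

Definition dopp (d : dir) : dir :=
  match d with N => S | E => W | S => N | W => E end.

Definition pos := (Z * Z)%type.
Definition shift (z : pos) (d : dir) : pos :=
  (fst z + fst (dvec d), snd z + snd (dvec d)).

(* A tile type maps each side to a glue label (glue alphabet = nat). *)
Definition tile := dir -> nat.

Definition assembly := pos -> option tile.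

Definition dom (A : assembly) (z : pos) : Prop := A z <> None.

Definition bond (str : nat -> Z) (A : assembly) (z : pos) (d : dir) : Z :=
  match A z, A (shift z d) with
  | Some t, Some u => if Nat.eqb (t d) (u (dopp d)) then str (t d) else 0
  | _, _ => 0
  end.

(* each undirected grid edge is represented uniquely as (z, E) or (z, N) *)
Definition edge := (pos * dir)%type.

Definition cut_edge (A : assembly) (P : pos -> Prop) (e : edge) : Prop :=
  (snd e = E \/ snd e = N) /\ dom A (fst e) /\ dom A (shift (fst e) (snd e)) /\
  (P (fst e) <-> ~ P (shift (fst e) (snd e))).

Definition edges_strength (str : nat -> Z) (A : assembly) (F : list edge) : Z :=
  fold_right (fun e acc => bond str A (fst e) (snd e) + acc) 0 F.

(* Total binding strength of the cut is >= tau.  For finite cuts this is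
   exactly "sum of strengths of all cut edges >= tau" (take F = all cut
   edges); for infinite cuts it means the (finite partial) sums are
   eventually >= tau. *)
Definition cut_strength_ge (str : nat -> Z) (tau : Z) (A : assembly)
    (P : pos -> Prop) : Prop :=
  exists F : list edge, (forall e, In e F -> cut_edge A P e) /\
    forall F' : list edge, NoDup F' -> incl F F' ->
      (forall e, In e F' -> cut_edge A P e) ->
      tau <= edges_strength str A F'.

Definition stable (str : nat -> Z) (tau : Z) (A : assembly) : Prop :=
  forall P : pos -> Prop,
    (exists z, dom A z /\ P z) -> (exists z, dom A z /\ ~ P z) ->
    cut_strength_ge str tau A P.

Definition attach (T : list tile) (str : nat -> Z) (tau : Z)
    (A B : assembly) : Prop :=
  exists (p : pos) (t : tile),
    A p = None /\ In t T /\
    (forall q, B q = if (Z.eqb (fst q) (fst p) && Z.eqb (snd q) (snd p))%bool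
                      then Some t else A q) /\
    stable str tau B.

(* A production: the union of a finite or infinite attachment sequence from
   the seed (finite sequences are encoded by eventually constant sequences). *)
Definition production (T : list tile) (str : nat -> Z) (tau : Z)
    (seed A : assembly) : Prop :=
  exists alpha : nat -> assembly,
    (forall q, alpha O q = seed q) /\
    (forall i, attach T str tau (alpha i) (alpha (Nat.succ i)) \/
               (forall q, alpha (Nat.succ i) q = alpha i q)) /\
    (forall q t, A q = Some t <-> exists i, alpha i q = Some t).

Definition terminal (T : list tile) (str : nat -> Z) (tau : Z)
    (A : assembly) : Prop :=
  forall B, ~ attach T str tau A B.

Definition finite_assembly (A : assembly) : Prop :=
  exists l : list pos, forall z, dom A z -> In z l.

Definition strictly_self_assembles (T : list tile) (str : nat -> Z) (tau : Z)
    (seed : assembly) (X : pos -> Prop) : Prop :=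
  forall A, production T str tau seed A -> terminal T str tau A ->
    forall z, dom A z <-> X z.

Definition gw (G : list (nat * nat)) : nat := Nat.succ (fold_right (fun p m => Nat.max (fst p) m) O G).
Definition gh (G : list (nat * nat)) : nat := Nat.succ (fold_right (fun p m => Nat.max (snd p) m) O G).

Definition sigma (G : list (nat * nat)) (X : nat * nat -> Prop) (p : nat * nat) : Prop :=
  X (Nat.div (fst p) (gw G), Nat.div (snd p) (gh G)) /\
  In (Nat.modulo (fst p) (gw G), Nat.modulo (snd p) (gh G)) G.

Definition Gpow (G : list (nat * nat)) (k : nat) : nat * nat -> Prop :=
  Nat.iter k (sigma G) (fun p => p = (O, O)).

Definition Ginf (G : list (nat * nat)) (p : nat * nat) : Prop :=
  exists k, Gpow G k p.

Definition in23 (n : nat) : bool := (Nat.eqb n 2 || Nat.eqb n 3)%bool.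

Definition K : list (nat * nat) :=
  filter (fun p => negb (in23 (fst p) && in23 (snd p))%bool)
         (list_prod (seq 0 6) (seq 0 6)).

Definition Kinf_Z (z : pos) : Prop :=
  exists x y : nat, z = (Z.of_nat x, Z.of_nat y) /\ Ginf K (x, y).

(* Main.v *)
(* A block of side 6^k whose lower left corner is a multiple of 6^k gets a state: the sides
   from which its assembly is fed, its place among the 36 children of its parent block, and
   for each side the content flowing through that side.  A state determines the states of
   the children, and there are finitely many, so that descending from the largest blocks
   labels every cell of the quadrant; the cells outside the holes become tiles whose glues
   are the contents of their sides.  A finite computation shows that the inputs of every cell
   but the origin have total strength exactly 2 and that a set of inputs determines the
   tile: wherever the contents around a cell (be it a hole) match all inputs of some tile, the
   cell is not a hole and carries that tile.
   Inputs come from cells of smaller height, for an order obtained by ranking children at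
   every scale.  Hence a part of the labelled quadrant which contains the inputs of all its
   cells is stable: in any cut, the lowest cell that is separated from the seed has its inputs
   on the other side.  Conversely a tile that attaches to such a part binds with total
   strength 2 along its inputs, so it is the intended one and all inputs of the cell are
   present.  Productions are therefore parts of this kind, and in a terminal one no lowest
   cell can be missing. *)
Require Import Defs.
From Stdlib Require Import ZArith List Bool Lia Arith FMapPositive Classical.
Import Defs ListNotations.
Local Open Scope nat_scope.
Local Open Scope bool_scope.

(** * The substitution *)

(* The orientation lists the sides which feed a block: W and S, only S, only W, S and E, or W and N.
   [Root] blocks contain the origin. *)
Inductive orientation := WS | S1 | W1 | SE | WN | Root | Hole.
Inductive family := FS1 | FW1 | FSE | FWN | FRT | FS | FW | FG.

(* A class tells what lies behind a side that flows N or E: a block with this single input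
   ([Start] and [Relay], bound with strength 2), a hole ([Blocked]), or the first or second
   of the blocks that turn the flow W inside an [S1] block ([Corner], [Second]). *)
Inductive class := Plain | Start | Corner | Second | Blocked | Relay (x : class).

(* Which symbols are displayed where was found by computer search: the design is justified by
   [check_true] alone. *)
Inductive symbol :=
| Blank | Digit (d : nat) (a b : class) (e : symbol)
  | Role (f : family) (i j : nat) (d : dir) (x : class)
| Joint (r k : symbol) | Base (v : bool) (n : nat) | Wrap (s : symbol) | Relay1 (c : class)
  | Relay2 (c : class) | Back
| Pass | Gate00 | Gate10 | Gate01 | GateN | GateE | GateEnd | GateRoot
  | GateIn (v : bool) (s : symbol).
Record content := Ct { flow : dir; code : symbol; extra : symbol }.
Record state := State { orient : orientation; parent : orientation; col : nat; row : nat;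
  kind : symbol;
  toN : option content; toE : option content; toS : option content; toW : option content }.

(** The suffix [_tr] marks reflection in the diagonal. It makes [W1] and [WN] the mirror images of
    [S1] and [SE], so that these two need no design of their own. In [Base] and [GateIn] a boolean
    tells two mirror images apart. *)
Definition dir_tr d := match d with N => E | E => N | S => W | W => S end.
Definition orient_tr o := match o with WS => WS | S1 => W1 | W1 => S1 | SE => WN | WN => SE
  | Root => Root | Hole => Hole end.
Definition family_tr f := match f with FS1 => FW1 | FW1 => FS1 | FSE => FWN | FWN => FSE
  | FRT => FRT
  | FS => FW | FW => FS | FG => FG end.
Fixpoint symbol_tr s := match s with
| Digit d a b e => Digit d a b (symbol_tr e)
| Role f i j d x => Role (family_tr f) j i (dir_tr d) x
| Joint r k => Joint (symbol_tr r) (symbol_tr k)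
| Base v n => Base (negb v) n
| Wrap s => Wrap (symbol_tr s)
| Gate10 => Gate01 | Gate01 => Gate10 | GateN => GateE | GateE => GateN
| GateIn v s => GateIn (negb v) (symbol_tr s)
| s => s end.
Definition side_tr (c : option content) :=
  match c with None => None | Some (Ct f r p) => Some (Ct (dir_tr f) (symbol_tr r) (symbol_tr
    p)) end.
Definition state_tr s := let '(State o p i j k n e s w) := s in
  State (orient_tr o) (orient_tr p) j i (symbol_tr k) (side_tr e) (side_tr n) (side_tr w)
    (side_tr s).

(* [orb] and [andb] would evaluate both arguments under call by value. *)
Notation "a ||| b" := (if a then true else b) (at level 50, left associativity).
Notation "a &&& b" := (if a then b else false) (at level 40, left associativity).
Definition hole i j := match i, j with 2, 2 | 2, 3 | 3, 2 | 3, 3 => true | _, _ => false end.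
Definition is_cell a b i j := (i =? a) &&& (j =? b).
(** The central hole deprives the children right of it of a west neighbour and those above it of a
    south neighbour. In every block outside the holes the former are therefore fed from S alone and
    the latter from W alone. *)
Definition layout0 o i j := match i, j with
| 2, 2 | 2, 3 | 3, 2 | 3, 3 => Hole
| 4, 2 | 4, 3 => S1
| 2, 4 | 3, 4 => W1
| _, _ => match o with
  | S1 => match i, j with 0, 0 | 2, 1 => S1 | 0, 1 | 1, 1 => SE | 0, _ => S1 | _, _ => WS end
  | SE => match i, j with _, 0 => SE | 0, _ => S1 | _, _ => WS end
  | Root => match i, j with 0, 0 => Root | _, 0 => W1 | 0, _ => S1 | _, _ => WS end
  | _ => WS end
end.
Definition layout o i j := match o with
| Hole => Hole | W1 | WN => orient_tr (layout0 (orient_tr o) j i) | _ => layout0 o i j end.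

Definition side (d : dir) s := match d with N => toN s | E => toE s | S => toS s | W => toW s end.
Definition side_code d s := match side d s with Some c => code c | None => Blank end.
Definition side_extra d s := match side d s with Some c => extra c | None => Blank end.

Definition is_S1 o := match o with S1 => true | _ => false end.
Definition is_W1 o := match o with W1 => true | _ => false end.
Definition is_WS o := match o with WS => true | _ => false end.
Definition is_hole o := match o with Hole => true | _ => false end.
Definition out_class o i j x :=
  if j =? 5 then Plain
  else if hole i (j + 1) then if is_W1 o then Plain else Blocked
  else if is_S1 o &&& is_cell 2 0 i j then Relay x
  else if is_S1 (layout o i (j + 1)) then Start
  else if is_S1 o &&& is_cell 0 0 i j then Corner
  else if is_S1 o &&& is_cell 1 0 i j then Second
  else Plain.
(** This is the class of the E side of the north neighbour. The last child along the shared side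
    lies in the corner where that E side begins, and [refine] hands it this class through
    [class5]. *)
Definition turn_class o i j x :=
  if (j =? 5) ||| (i =? 5) ||| negb (is_WS (layout o i (j + 1))) then Plain
  else out_class (orient_tr o) (j + 1) i x.
Definition class0 s := match s with
| Digit _ a _ _ => a
| Role f i j N x | Role f i j E x =>
   match f with
   | FS1 | FW1 => if is_cell 0 0 i j then Corner
     else if is_cell 1 0 i j ||| is_cell 0 1 i j then Second else Relay x
   | _ => Start end
| _ => Plain end.
Definition class5 s := match s with Digit _ _ b _ => b | _ => Plain end.
Definition is_start s := match class0 s with Start | Relay _ => true | _ => false end.
Definition plain_class s := match class0 s with Relay _ => Plain | c => c end.
Definition symbolN o i j ex x :=
  match out_class o i j x with
  | Plain => Digit i Plain (turn_class o i j x) ex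
  | Blocked => Digit i Blocked (turn_class o i j x) ex
  | a => Role (if is_cell 4 1 i j ||| is_cell 4 2 i j then FG
    else if (i =? 0) &&& negb (j =? 0) then FS
               else match o with S1 => FS1 | SE => FSE | Root => FRT | W1 => FW1 | WN => FWN
                 | _ => FG end)
              i j N (match a with Relay _ => x | _ => Plain end) end.
Definition symbolE o i j ex x := symbol_tr (symbolN (orient_tr o) j i (symbol_tr ex) x).

(* The first two children along a side carry the information of the side: the [extra] symbol
   of child 0 is the [code] of the side and that of child 1 is its [extra] symbol.  A side that
   flows W or S does so at child 0 only; the other children flow back. *)
Definition refine (c : option content) (d : nat) := match c with
| None => None
| Some (Ct f r p) => Some (match f with
  | N | E => match d with
     | 0 => Ct f (Digit 0 (class0 r) Plain Blank) r
     | 1 => Ct f (Digit 1 Plain Plain Blank) p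
     | 5 => Ct f (Digit 5 Plain (class5 r) Blank) Blank
     | _ => Ct f (Digit d Plain Plain Blank) Blank end
  | _ => match d with 0 => Ct f Back p
    | _ => Ct (dopp f) (Digit d Plain Plain Blank) Blank end end) end.
(** As an argument, [Hole] is a wildcard that admits every parent. *)
Definition has_role o i j s := match parent s, o with
| WS, WS | S1, S1 | W1, W1 | _, Hole => (col s =? i) &&& (row s =? j) | _, _ => false end.
Definition start_code s := if has_role S1 0 0 s then Base true 3 else side_code E s.
Definition child_kind o s i j :=
  let k := if is_cell 5 5 i j then GateEnd else if is_cell 5 0 i j then GateN
    else if is_cell 0 5 i j then GateE else Pass in
  match o with
  | WS => if is_cell 0 0 i j then Gate00 else if is_cell 1 0 i j then Gate10
    else if is_cell 0 1 i j then Gate01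
          else if is_cell 1 1 i j then kind s else k
  | S1 => if is_cell 1 0 i j then GateIn true (start_code s) else k
  | Root => if is_cell 1 1 i j then GateRoot else k
  | _ => k end.
Definition first_extraE s := if has_role WS 0 1 s then Base true 0
  else if has_role Hole 5 5 s then Base true 1
  else if has_role S1 1 0 s then Base true 2 else side_code E s.
Definition first_extraN s := Joint (if has_role Hole 5 5 s then Base false 1
  else if has_role W1 0 1 s then Base false 2 else side_code N s) (kind s).
Definition extraE o s i j := match o with
| WS => match j with 0 => if i =? 0 then first_extraE s else side_code E s
        | 1 => if i =? 0 then side_extra W s else side_extra E s
        | 5 => side_code N s | _ => Blank end
| S1 => if (j =? 0) &&& negb (i =? 0) then side_code E s else Blank
| Root => match j with 0 => side_code E s | 1 => if i =? 0 then Blank else side_extra E s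
  | _ => Blank end
| _ => Blank end.
Definition extraN o s i j := match o with
| WS => match i with 0 => if j =? 0 then first_extraN s else side_code N s
        | 1 => if j =? 0 then side_extra S s else side_extra N s
        | 5 => side_code E s | _ => Blank end
| S1 => match i with 0 => if j =? 0 then side_code S s else side_code N s
        | 1 => if j =? 0 then Wrap (side_extra S s) else side_extra S s
        | 5 => side_code E s | _ => Blank end
| SE => match i with 0 => side_code N s | 1 => side_extra N s | _ => Blank end
| Root => match i with 0 => side_code N s | 1 => if j =? 0 then Blank else side_extra N s
  | _ => Blank end
| _ => Blank end.
Definition extraW o s i := match o with
| S1 => if i =? 2 then Relay1 (plain_class (side_extra S s))
  else Relay2 (plain_class (side_extra S s))
| _ => side_extra E s end.
Definition inner_symbolE o s i j := symbolE o i j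
  (match o with WS => if is_cell 0 1 i j then kind s else Blank
   | Root => if is_cell 0 1 i j then GateRoot else Blank
   | S1 => if is_cell 0 0 i j then start_code s else Blank | _ => Blank end)
  (match o with S1 => plain_class (side_extra S s) | _ => Plain end).
Definition inner_symbolN o s i j := symbolN o i j
  (match o with Root => if is_cell 1 0 i j then GateRoot else Blank | _ => Blank end)
  (match o with S1 => plain_class (side_extra S s) | _ => Plain end).

(* The side between the children (i, j) and (i + 1, j). *)
Definition innerE o s i j :=
  match layout o i j with
  | Hole => None
  | a => match layout o (i + 1) j, a with
     | Hole, _ => Some (Ct E (inner_symbolE o s i j) (extraE o s i j))
     | _, SE => Some (Ct W (Role (match o with S1 => FS1
       | _ => FSE end) (i + 1) j W Plain) (extraW o s (i + 1)))
     | _, _ => Some (Ct E (inner_symbolE o s i j) (extraE o s i j)) end end.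
Definition innerN o s i j :=
  match layout o i j with
  | Hole => None
  | _ => Some (Ct N (inner_symbolN o s i j) (extraN o s i j)) end.

(* The orientation [o] is never [W1] or [WN]: these are treated by transposition. *)
Definition child0 o s i j :=
  State (layout o i j) o i j (child_kind o s i j)
     (if j =? 5 then refine (toN s) i else innerN o s i j)
     (if i =? 5 then refine (toE s) j else innerE o s i j)
     (match j with 0 => refine (toS s) i | Datatypes.S j' => innerN o s i j' end)
     (match i with 0 => refine (toW s) j | Datatypes.S i' => innerE o s i' j end).
Definition hole_child s i j :=
  State Hole Hole 0 0 Blank (if j =? 5 then refine (toN s) i else None) (if i =? 5
    then refine (toE s) j else None)
    (if j =? 0 then refine (toS s) i else None) (if i =? 0 then refine (toW s) j else None).
Definition forget_role s := State Hole Hole 0 0 Blank (toN s) (toE s) (toS s) (toW s).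

(* Erasing the place of a hole keeps the number of states small. *)
Definition normalize s := if is_hole (orient s) then forget_role s else s.
Definition child s := match orient s with
| Hole => hole_child s
| W1 | WN => let t := state_tr s in fun i j => normalize (state_tr (child0 (orient t) t j i))
| o => fun i j => normalize (child0 o s i j) end.
(** Its contents are chosen such that [child root 0 0] is [root] again; hence the block at the
    origin has the same state at every scale. *)
Definition root := State Root Root 0 0 Pass
  (Some (Ct N (symbolN Root 0 0 Blank Plain) (symbolN Root 0 0 Blank Plain)))
  (Some (Ct E (symbolE Root 0 0 Blank Plain) (symbolE Root 0 0 Blank Plain))) None None.

(** * Encodings and the finite check *)

(* Encoders prepend a prefix code to the positive number [k]. *)
Fixpoint enc_nat (n : nat) (k : positive) : positive := match n with 0 => xO k
  | Datatypes.S n => xI (enc_nat n k) end.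
Definition dir_num d := match d with N => 0 | E => 1 | S => 2 | W => 3 end.
Definition orient_num o := match o with WS => 0 | S1 => 1 | W1 => 2 | SE => 3 | WN => 4
  | Root => 5 | Hole => 6 end.
Definition family_num f := match f with FG => 0 | FS => 1 | FW => 2 | FS1 => 3 | FW1 => 4
  | FSE => 5 | FWN => 6 | FRT => 7 end.
Definition bool_num (b : bool) := if b then 0 else 1.
Fixpoint enc_class c k := match c with Plain => enc_nat 0 k | Start => enc_nat 1 k
  | Corner => enc_nat 2 k | Second => enc_nat 3 k | Blocked => enc_nat 4 k
| Relay c => enc_nat 5 (enc_class c k) end.
Fixpoint enc_symbol s k := match s with
| Blank => enc_nat 0 k
| Digit d a b e => enc_nat 1 (enc_nat d (enc_class a (enc_class b (enc_symbol e k))))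
| Role f i j d x => enc_nat 2 (enc_nat (family_num f) (enc_nat i (enc_nat j (enc_nat (dir_num d)
  (enc_class x k)))))
| Joint r q => enc_nat 3 (enc_symbol r (enc_symbol q k))
| Pass => enc_nat 4 k | Gate01 => enc_nat 5 k | Gate10 => enc_nat 6 k
| Base v n => enc_nat 7 (enc_nat (bool_num v) (enc_nat n k))
| Wrap s => enc_nat 8 (enc_symbol s k)
| Relay1 c => enc_nat 9 (enc_class c k) | Relay2 c => enc_nat 10 (enc_class c k)
  | Back => enc_nat 11 k
| Gate00 => enc_nat 12 k | GateN => enc_nat 13 k | GateE => enc_nat 14 k
  | GateEnd => enc_nat 15 k | GateRoot => enc_nat 16 k
| GateIn v s => enc_nat 17 (enc_nat (bool_num v) (enc_symbol s k)) end.
Definition enc_content (c : content) k :=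
  enc_nat (dir_num (flow c)) (enc_symbol (code c) (enc_symbol (extra c) k)).
Definition enc_side c k := match c with None => xO k | Some c => xI (enc_content c k) end.
Definition enc_state s := enc_nat (orient_num (orient s)) (enc_nat (orient_num (parent s))
  (enc_nat (col s) (enc_nat (row s) (enc_symbol (kind s)
  (enc_side (toN s) (enc_side (toE s) (enc_side (toS s) (enc_side (toW s) xH)))))))).

Definition digits := [0;1;2;3;4;5].
Definition cells := list_prod digits digits.
Definition children s := let c := child s in map (fun p => c (fst p) (snd p)) cells.
Definition visit (a : PositiveMap.t unit * list state) (c : state) :=
  let k := enc_state c in
  match PositiveMap.find k (fst a) with
  | Some _ => a | None => (PositiveMap.add k tt (fst a), c :: snd a) end.
Fixpoint explore fuel (m : PositiveMap.t unit) (todo acc : list state) : option (list state) :=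
  match todo with
  | [] => Some acc
  | s :: r => match fuel with 0 => None | Datatypes.S fuel =>
      let '(m, r) := fold_left visit (children s) (m, r) in explore fuel m r (s :: acc) end end.

Definition input o d := match o, d with
| WS, W | WS, S | S1, S | W1, W | SE, S | SE, E | WN, W | WN, N => true | _, _ => false end.
Definition dir_eqb a b := dir_num a =? dir_num b.
Definition dirs := [N; E; S; W].
Definition is_strong c := match flow c with N | E => is_start (code c) | _ => false end.
Definition strength (c : option content) := match c with None => 0
  | Some c => if is_strong c then 2 else 1 end.

(* A tile exposes a glue only where it is fed or where the content flows out. *)
Definition own s d := match side d s with
| None => None | Some c => if input (orient s) d then Some c else if dir_eqb (flow c) d
  then Some c else None end.
Definition enc_tile s := enc_side (own s N) (enc_side (own s E) (enc_side (own s S) (enc_side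
  (own s W) xH))).
(** The orientation is a separate argument because the surroundings of any cell, even of a hole, are
    to be looked up as possible inputs of a tile of orientation [o]. *)
Definition input_key o s := let f d := enc_side (if input o d then side d s else None) in
  enc_nat (orient_num o) (f N (f E (f S (f W xH)))).
Definition flows_in d s := match side d s with None => false
  | Some c => dir_eqb (flow c) (dopp d) end.
Definition inputs_flow_in o s := forallb (fun d => if input o d then flows_in d s else true) dirs.
Definition input_strength o s := list_sum (map (fun d => if input o d
  then strength (side d s) else 0) dirs).
Definition is_root o := match o with Root => true | _ => false end.
(** Entries with equal keys overwrite each other. A clash is caught by [forced], applied to the
    state whose tile was lost and to its own orientation. *)
Definition tile_map l := fold_left (fun m s => if is_hole (orient s) ||| is_root (orient s) then m
  else PositiveMap.add (input_key (orient s) s) (enc_tile s) m) l (PositiveMap.empty positive).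
Definition well_fed s := inputs_flow_in (orient s) s &&& (input_strength (orient s) s =? 2).
Definition is_mapped (m : PositiveMap.t positive) s :=
  match PositiveMap.find (input_key (orient s) s) m with Some _ => true | None => false end.

(* If all inputs of a tile of orientation [o] are present around [s], then [s] is this tile. *)
Definition forced (m : PositiveMap.t positive) s o :=
  if inputs_flow_in o s then
    match PositiveMap.find (input_key o s) m with
    | None => true | Some v => if is_hole (orient s) then false else Pos.eqb v (enc_tile s) end
  else true.
Definition state_ok m s := is_root (orient s) |||
  (is_hole (orient s) ||| (well_fed s &&& is_mapped m s)) &&& forallb (forced m s) [WS; S1; W1;
    SE; WN].
Definition all_ok l := let m := tile_map l in forallb (state_ok m) l.
Definition check fuel :=
  match explore fuel (PositiveMap.add (enc_state root) tt (PositiveMap.empty _)) [root] [] with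
  | Some l => all_ok l | None => false end.

(* There are 14811 reachable states, each of which uses one unit of fuel. *)
Lemma check_true : check (N.to_nat 20000) = true.
Proof. vm_cast_no_check (eq_refl true). Qed.

(** The remainders [k] and [l] occur in this and the later injectivity lemmas so that a
    concatenation of prefix codes can be decoded field by field. *)
Lemma enc_nat_inj a b k l : enc_nat a k = enc_nat b l -> a = b /\ k = l.
Proof.
  revert b; induction a as [|a IH]; destruct b as [|b]; simpl; intro H; try discriminate H;
    injection H as H.
  - auto.
  - destruct (IH _ H); auto.
Qed.

Lemma dir_num_inj a b : dir_num a = dir_num b -> a = b.
Proof. destruct a, b; simpl; congruence. Qed.

Lemma orient_num_inj a b : orient_num a = orient_num b -> a = b.
Proof. destruct a, b; simpl; congruence. Qed.

Lemma family_num_inj a b : family_num a = family_num b -> a = b.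
Proof. destruct a, b; simpl; congruence. Qed.

Lemma bool_num_inj a b : bool_num a = bool_num b -> a = b.
Proof. destruct a, b; simpl; congruence. Qed.

Lemma enc_class_inj a b k l : enc_class a k = enc_class b l -> a = b /\ k = l.
Proof.
  revert b k l; induction a; destruct b; intros k l H; cbn [enc_class] in H;
    apply enc_nat_inj in H as [H0 H]; try discriminate H0; auto.
  apply IHa in H as []; subst; auto.
Qed.

Ltac peel := repeat match goal with
  | H : enc_nat _ _ = enc_nat _ _ |- _ => apply enc_nat_inj in H as []
  | H : dir_num _ = dir_num _ |- _ => apply dir_num_inj in H
  | H : orient_num _ = orient_num _ |- _ => apply orient_num_inj in H
  | H : family_num _ = family_num _ |- _ => apply family_num_inj in H
  | H : bool_num _ = bool_num _ |- _ => apply bool_num_inj in H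
  | H : enc_class _ _ = enc_class _ _ |- _ => apply enc_class_inj in H as [] end.
Lemma enc_symbol_inj a b k l : enc_symbol a k = enc_symbol b l -> a = b /\ k = l.
Proof.
  revert b k l; induction a; intros b'; destruct b'; intros k' l' H; cbn [enc_symbol] in H;
    apply enc_nat_inj in H as [H0 H]; try discriminate H0; clear H0; peel; subst; auto;
  repeat match goal with
  | IH : forall b k l, enc_symbol ?a k = enc_symbol b l ->
    _, H : enc_symbol ?a _ = enc_symbol _ _ |- _ => apply IH in H as []
  end; peel; subst; auto.
Qed.

Lemma enc_content_inj a b k l : enc_content a k = enc_content b l -> a = b /\ k = l.
Proof.
  destruct a as [f r p], b as [f' r' p']; unfold enc_content; cbn [flow code extra]; intro H.
  apply enc_nat_inj in H as [?%dir_num_inj H]; apply enc_symbol_inj in H as [? H];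
    apply enc_symbol_inj in H as []; subst; auto.
Qed.

Lemma enc_side_inj a b k l : enc_side a k = enc_side b l -> a = b /\ k = l.
Proof.
  destruct a, b; cbn [enc_side]; intro H; try discriminate H; injection H as H; auto.
  apply enc_content_inj in H as []; subst; auto.
Qed.

Lemma enc_state_inj a b : enc_state a = enc_state b -> a = b.
Proof.
  destruct a as [o p i j k n e s w], b as [o' p' i' j' k' n' e' s' w'].
  unfold enc_state; cbn [orient parent col row kind toN toE toS toW]; intro H.
  do 2 apply enc_nat_inj in H as [?%orient_num_inj H]. do 2 apply enc_nat_inj in H as [? H].
  apply enc_symbol_inj in H as [? H]. do 4 (apply enc_side_inj in H as [? H]). subst; auto.
Qed.

Lemma enc_tile_inj a b : enc_tile a = enc_tile b -> forall d, own a d = own b d.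
Proof.
  unfold enc_tile; intros H d; do 4 (apply enc_side_inj in H as [? H]); destruct d; auto.
Qed.

(** * Correctness of the exploration *)

Lemma visit_spec cs : forall m r m' r', fold_left visit cs (m, r) = (m', r') ->
  (forall k, PositiveMap.find k m <> None -> PositiveMap.find k m' <> None) /\
  (forall k, PositiveMap.find k m' <> None ->
    PositiveMap.find k m <> None \/ exists c, In c r' /\ enc_state c = k) /\
  incl r r' /\ (forall c, In c cs -> PositiveMap.find (enc_state c) m' <> None).
Proof.
  induction cs as [|c cs IH]; intros m r m' r' H; simpl in H.
  - injection H as <- <-. simpl; repeat split; auto using incl_refl; tauto.
  - unfold visit in H at 2. simpl in H. destruct (PositiveMap.find (enc_state c) m) eqn:F.
    + apply IH in H as (A & B & C & D). repeat split; auto.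
      intros c' [<-|]; auto. apply A. congruence.
    + apply IH in H as (A & B & C & D).
      assert (A' : forall k, PositiveMap.find k (PositiveMap.add (enc_state c) tt m) <> None <->
        k = enc_state c \/ PositiveMap.find k m <> None).
      { intro k. destruct (Pos.eq_dec k (enc_state c)) as [->|n].
        - rewrite PositiveMap.gss. split; auto; discriminate.
        - rewrite PositiveMap.gso by auto. tauto. }
      repeat split.
      * intros k Hk; apply A, A'; auto.
      * intros k Hk. apply B in Hk as [Hk|]; auto. apply A' in Hk as [->|]; auto.
        right; exists c; split; auto. apply C; simpl; auto.
      * intros x Hx; apply C; simpl; auto.
      * intros x [<-|Hx]; auto. apply A, A'; auto.
Qed.

Definition keyed m (l : list state) := forall k, @PositiveMap.find unit k m <> None ->
  exists c, In c l /\ enc_state c = k.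
(** The invariant is that each marked key belongs to a state that is waiting or processed, and that
    the children of processed states are marked. Once nothing waits, the processed states are closed
    under children. *)
Lemma explore_spec fuel : forall m todo acc l, explore fuel m todo acc = Some l ->
  keyed m (todo ++ acc) ->
  (forall s c, In s acc -> In c (children s) -> PositiveMap.find (enc_state c) m <> None) ->
  incl (todo ++ acc) l /\ forall s c, In s l -> In c (children s) -> In c l.
Proof.
  induction fuel as [|fuel IH]; intros m todo acc l; destruct todo as [|s r]; cbn [explore app];
    intros H K C;
    try discriminate H.
  1,2: injection H as <-; split; [apply incl_refl|]; intros s c Hs Hc;
    destruct (K _ (C _ _ Hs Hc)) as (c' & Hc' & e); apply enc_state_inj in e; congruence.
  destruct (fold_left visit (children s) (m, r)) as [m' r'] eqn:V.
  apply visit_spec in V as (A & B & D & F).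
  apply IH in H as [H1 H2].
  - split; auto. intros x Hx. apply H1. simpl in Hx. rewrite in_app_iff in *. simpl. intuition.
  - intros k Hk. apply B in Hk as [Hk|(c & Hc & e)].
    + apply K in Hk as (c & Hc & e). exists c; split; auto. simpl in Hc.
    rewrite in_app_iff in *. simpl. intuition.
    + exists c; split; auto. apply in_app_iff; auto.
  - intros x c [<-|Hx] Hc; auto. eapply A, C; eauto.
Qed.

Lemma digits_in i : i < 6 -> In i digits.
Proof. unfold digits; simpl; lia. Qed.

Lemma child_in_children s i j : i < 6 -> j < 6 -> In (child s i j) (children s).
Proof.
  intros. unfold children. apply (in_map (fun p => child s (fst p) (snd p)) cells (i, j)).
  apply in_prod; apply digits_in; auto.
Qed.

Lemma check_spec fuel : check fuel = true -> exists l, In root l /\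
  (forall s i j, In s l -> i < 6 -> j < 6 -> In (child s i j) l) /\ all_ok l = true.
Proof.
  unfold check. destruct (explore _ _ _ _) as [l|] eqn:F; [|discriminate]. intro H.
  exists l. apply explore_spec in F as [A B].
  - repeat split; auto.
    + apply A; simpl; auto.
    + intros; eapply B; eauto using child_in_children.
  - intros k Hk. exists root. split; [simpl; auto|].
    destruct (Pos.eq_dec k (enc_state root)) as [->|n]; auto.
    rewrite PositiveMap.gso in Hk by auto. rewrite PositiveMap.gempty in Hk. congruence.
  - intros s c [].
Qed.

Lemma dir_eqb_eq a b : dir_eqb a b = true -> a = b.
Proof. unfold dir_eqb. intro H. apply Nat.eqb_eq in H. apply dir_num_inj; auto. Qed.

Lemma is_hole_eq o : is_hole o = true <-> o = Hole.
Proof. destruct o; simpl; split; congruence. Qed.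

Lemma is_root_eq o : is_root o = true <-> o = Root.
Proof. destruct o; simpl; split; congruence. Qed.

Definition fits o s := forall d, input o d = true -> exists c, side d s = Some c /\
  flow c = dopp d.
Lemma inputs_flow_in_fits o s : inputs_flow_in o s = true <-> fits o s.
Proof.
  unfold inputs_flow_in, fits, flows_in. rewrite forallb_forall. split; intros H d Hd.
  - specialize (H d). rewrite Hd in H. destruct (side d s) as [c|].
    + exists c; split; auto. apply dir_eqb_eq, H. destruct d; simpl; auto.
    + discriminate H. destruct d; simpl; auto.
  - destruct (input o d) eqn:E; auto. apply H in E as (c & -> & ->). unfold dir_eqb.
  apply Nat.eqb_refl.
Qed.

Lemma input_key_ext o s s' : (forall d, input o d = true -> side d s = side d s') ->
  input_key o s = input_key o s'.
Proof.
  intro H. unfold input_key.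
  assert (G : forall d, (if input o d then side d s else None) = if input o d
    then side d s' else None).
  { intro d. destruct (input o d) eqn:E; auto. }
  rewrite !G. auto.
Qed.

(** The second part is the determinism of the design: surroundings that agree with [s'] along the
    inputs of [s'] belong to a cell with the same exposed contents. *)
Lemma all_ok_spec l : all_ok l = true ->
  (forall s, In s l -> orient s <> Hole -> orient s <> Root -> fits (orient s) s /\
    input_strength (orient s) s = 2) /\
  (forall s s', In s l -> In s' l -> orient s <> Root -> orient s' <> Hole -> orient s' <> Root ->
    (forall d, input (orient s') d = true -> side d s = side d s') ->
    orient s <> Hole /\ forall d, own s d = own s' d).
Proof.
  unfold all_ok. generalize (tile_map l) as m. intros m H. rewrite forallb_forall in H.
  assert (A : forall s, In s l -> orient s <> Hole -> orient s <> Root -> fits (orient s) s /\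
    input_strength (orient s) s = 2 /\ is_mapped m s = true).
  { intros s Hs h r. apply H in Hs. unfold state_ok in Hs. rewrite <- is_hole_eq in h.
  rewrite <- is_root_eq in r.
    destruct (is_root (orient s)); [congruence|]. destruct (is_hole (orient s)); [congruence|].
    unfold well_fed in Hs. destruct (inputs_flow_in (orient s) s) eqn:I; [|discriminate].
    apply inputs_flow_in_fits in I.
    destruct (input_strength (orient s) s =? 2) eqn:J; [|discriminate]. apply Nat.eqb_eq in J.
    destruct (is_mapped m s); [auto|discriminate]. }
  assert (B : forall s o, In s l -> orient s <> Root -> o <> Hole -> o <> Root ->
    forced m s o = true).
  { intros s o Hs r h' r'. apply H in Hs. unfold state_ok in Hs. rewrite <- is_root_eq in r.
    destruct (is_root (orient s)); [congruence|].
    destruct (if is_hole (orient s) then true else _); [|discriminate].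
    rewrite forallb_forall in Hs. apply Hs. destruct o; simpl; tauto. }
  split.
  - intros s Hs h r. destruct (A s Hs h r) as (? & ? & _); auto.
  - intros s s' Hs Hs' r h' r' E.
    destruct (A s' Hs' h' r') as (F & _ & Kn).
    (* By [E] both lookups use the same key, so that the value found encodes the tiles of [s] and of
       [s']. *)
    pose proof (B _ _ Hs r h' r') as B1. pose proof (B _ _ Hs' r' h' r') as B2.
    unfold forced in B1, B2. rewrite (input_key_ext _ _ _ E) in B1.
    rewrite (proj2 (inputs_flow_in_fits _ _) F) in B2.
    rewrite (proj2 (inputs_flow_in_fits (orient s') s)) in B1.
    2:{ intros d Hd. rewrite E by auto. auto. }
    unfold is_mapped in Kn. destruct (PositiveMap.find _ m) as [v|]; [|discriminate].
    destruct (is_hole (orient s)) eqn:h; [discriminate|].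
    destruct (is_hole (orient s')); [discriminate|].
    apply Pos.eqb_eq in B1, B2. split.
    + rewrite <- is_hole_eq. congruence.
    + apply enc_tile_inj. congruence.
Qed.

(** * The labelled quadrant *)

Lemma symbol_trK s : symbol_tr (symbol_tr s) = s.
Proof.
  induction s; simpl; repeat match goal with b : bool |- _ => destruct b
    | f : family |- _ => destruct f | d : dir |- _ => destruct d end;
  simpl; congruence.
Qed.

Lemma dir_trK d : dir_tr (dir_tr d) = d.
Proof. destruct d; auto. Qed.

Lemma class0_tr s : class0 (symbol_tr s) = class0 s.
Proof.
  destruct s; auto. simpl. unfold is_cell.
  destruct f, d; auto; cbn; destruct i as [|[|i]], j as [|[|j]]; auto.
Qed.

Lemma class5_tr s : class5 (symbol_tr s) = class5 s.
Proof. destruct s; auto. Qed.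

Lemma refine_tr c d : side_tr (refine (side_tr c) d) = refine c d.
Proof.
  destruct c as [[f r p]|]; auto. cbn [side_tr].
  destruct f; cbn [dir_tr refine]; do 6 (destruct d as [|d];
    cbn [side_tr dir_tr symbol_tr dopp]; rewrite ?class0_tr, ?class5_tr, ?symbol_trK; auto).
Qed.

Lemma side_state_tr d s : side d (state_tr s) = side_tr (side (dir_tr d) s).
Proof. destruct s, d; auto. Qed.

Lemma side_normalize d s : side d (normalize s) = side d s.
Proof. unfold normalize. destruct (is_hole (orient s)), d; auto. Qed.

Lemma orient_normalize s : orient (normalize s) = orient s.
Proof. unfold normalize, forget_role. destruct s as [o]; destruct o; auto. Qed.

Lemma orient_state_tr s : orient (state_tr s) = orient_tr (orient s).
Proof. destruct s; auto. Qed.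

Definition direct o := match o with W1 | WN | Hole => false | _ => true end.
Lemma child_direct s i j : direct (orient s) = true ->
  child s i j = normalize (child0 (orient s) s i j).
Proof. unfold child. destruct (orient s); simpl; congruence. Qed.

Lemma child_transposed s i j : orient s = W1 \/ orient s = WN ->
  child s i j = normalize (state_tr (child0 (orient_tr (orient s)) (state_tr s) j i)).
Proof. unfold child. intros [H|H]; rewrite <- orient_state_tr, H; auto. Qed.

Lemma orient_cases o : direct o = true \/ (o = W1 \/ o = WN) \/ o = Hole.
Proof. destruct o; auto. Qed.

Lemma orient_child s i j : orient (child s i j) = layout (orient s) i j.
Proof.
  destruct (orient_cases (orient s)) as [H|[H|H]].
  - rewrite child_direct, orient_normalize by auto. cbn. unfold layout. destruct (orient s);
    auto; discriminate.
  - rewrite child_transposed, orient_normalize, orient_state_tr by auto. cbn. unfold layout.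
    destruct H as [-> | ->]; auto.
  - unfold child. rewrite H. auto.
Qed.

Ltac child_cases s :=
  destruct (orient_cases (orient s)) as [H|[H|H]];
  [rewrite ?(child_direct s) by auto; rewrite ?side_normalize
  |rewrite ?(child_transposed s) by auto; rewrite ?side_normalize, ?side_state_tr
  |unfold child; rewrite H].
(** The contents along an outer side of a block depend on the content of that side alone. Two
    neighbouring blocks thus refine their common side in the same way. *)
Lemma side_W_child s j : side W (child s 0 j) = refine (side W s) j.
Proof.
  child_cases s; cbn; auto. destruct s; cbn. apply refine_tr.
Qed.

Lemma side_S_child s i : side S (child s i 0) = refine (side S s) i.
Proof. child_cases s; cbn; auto. destruct s; cbn. apply refine_tr. Qed.

Lemma side_E_child s j : side E (child s 5 j) = refine (side E s) j.
Proof. child_cases s; cbn; auto. destruct s; cbn. apply refine_tr. Qed.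

Lemma side_N_child s i : side N (child s i 5) = refine (side N s) i.
Proof. child_cases s; cbn; auto. destruct s; cbn. apply refine_tr. Qed.

Lemma side_E_W s i j : i < 5 -> side E (child s i j) = side W (child s (i + 1) j).
Proof.
  intro L. rewrite Nat.add_1_r.
  assert (E : (i =? 5) = false) by (apply Nat.eqb_neq; lia).
  child_cases s; cbn [side toE toW toN toS dir_tr child0 hole_child Nat.eqb]; rewrite ?E; auto.
Qed.

Lemma side_N_S s i j : j < 5 -> side N (child s i j) = side S (child s i (j + 1)).
Proof.
  intro L. rewrite Nat.add_1_r.
  assert (E : (j =? 5) = false) by (apply Nat.eqb_neq; lia).
  child_cases s; cbn [side toE toW toN toS dir_tr child0 hole_child Nat.eqb]; rewrite ?E; auto.
Qed.

(* An order in which the children of a block can be attached. *)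
Definition orderS1 i j := if j =? 1 then 6 + (if i <=? 2 then 2 - i else i) else 6 * j + i.
Definition orderSE i j := if j =? 0 then 5 - i else 6 * j + i.
Definition order o i j := match o with
  | S1 => orderS1 i j | W1 => orderS1 j i | SE => orderSE i j | WN => orderSE j i
    | _ => 6 * j + i end.

Definition orientations := [WS; S1; W1; SE; WN; Root; Hole].
Lemma in_orientations o : In o orientations.
Proof. destruct o; simpl; tauto. Qed.

Definition before o i j i' j' := negb (is_hole (layout o i' j')) && (order o i' j' <? order o i
  j).
(** For a child at the margin, the neighbour may lie in another block; then the block itself has to
    be fed from there. *)
Definition locally_fed o i j d :=
  match d with
  | E => if i =? 5 then input o E else before o i j (i + 1) j
  | N => if j =? 5 then input o N else before o i j i (j + 1)
  | W => if i =? 0 then input o W else before o i j (i - 1) j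
  | S => if j =? 0 then input o S else before o i j i (j - 1) end.
Definition layout_ok o i j :=
  (order o i j <? 36) &&
  (Bool.eqb (is_hole (layout o i j)) (is_hole o || hole i j)) &&
  (if is_root (layout o i j) then is_root o && ((i =? 0) && (j =? 0)) else true) &&
  forallb (fun d => if input (layout o i j) d then locally_fed o i j d else true) dirs.
Lemma layouts_ok : forallb (fun o => forallb (fun p => layout_ok o (fst p) (snd p)) cells)
  orientations = true.
Proof. vm_compute. reflexivity. Qed.

Lemma layout_ok_true o i j : i < 6 -> j < 6 -> layout_ok o i j = true.
Proof.
  intros. generalize layouts_ok. rewrite forallb_forall. intro T.
  specialize (T _ (in_orientations o)). cbv beta in T. rewrite forallb_forall in T.
  apply (T (i, j)). apply in_prod; apply digits_in; auto.
Qed.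

Lemma order_lt o i j : i < 6 -> j < 6 -> order o i j < 36.
Proof.
  intros Hi Hj. generalize (layout_ok_true o i j Hi Hj). unfold layout_ok.
  rewrite !andb_true_iff, Nat.ltb_lt. tauto.
Qed.

Lemma layout_hole o i j : i < 6 -> j < 6 -> layout o i j = Hole <-> o = Hole \/ hole i j = true.
Proof.
  intros Hi Hj. generalize (layout_ok_true o i j Hi Hj). unfold layout_ok.
  rewrite !andb_true_iff, Bool.eqb_true_iff, <- !is_hole_eq.
  intros (((_ & ->) & _) & _). destruct (is_hole o), (hole i j); intuition.
Qed.

Lemma layout_root o i j : i < 6 -> j < 6 -> layout o i j = Root -> o = Root /\ i = 0 /\ j = 0.
Proof.
  intros Hi Hj. generalize (layout_ok_true o i j Hi Hj). unfold layout_ok.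
  rewrite !andb_true_iff, <- !is_root_eq.
  intros ((_ & H) & _) E. rewrite E in H. rewrite !andb_true_iff, !Nat.eqb_eq in H. tauto.
Qed.

Lemma layout_input o i j d : i < 6 -> j < 6 -> input (layout o i j) d = true ->
  locally_fed o i j d = true.
Proof.
  intros Hi Hj. generalize (layout_ok_true o i j Hi Hj). unfold layout_ok. rewrite !andb_true_iff.
  intros (_ & H) E. rewrite forallb_forall in H. specialize (H d). rewrite E in H. apply H.
  destruct d; simpl; tauto.
Qed.

(** The square of side [6 ^ k] at the origin is subdivided [k] times. The rank has the positions in
    the orders as digits in base 36, the largest scale leading, so that ranks compare
    lexicographically. *)
Fixpoint block_rank k x y : state * nat := match k with
  | O => (root, 0)
  | Datatypes.S k => let (s, r) := block_rank k (x / 6) (y / 6) in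
      (child s (x mod 6) (y mod 6), 36 * r + order (orient s) (x mod 6) (y mod 6)) end.
Lemma block_rank_S k : forall x y, x < 6 ^ k -> y < 6 ^ k ->
  block_rank (Datatypes.S k) x y = block_rank k x y.
Proof.
  induction k as [|k IH]; intros x y Hx Hy.
  (* Here the fixed point [child root 0 0 = root] is computed, together with the order 0 of this
     child. *)
  - simpl in Hx, Hy. replace x with 0 by lia. replace y with 0 by lia. reflexivity.
  - cbn [block_rank]. cbn [block_rank] in IH. rewrite Nat.pow_succ_r' in Hx, Hy.
    rewrite IH by (apply Nat.Div0.div_lt_upper_bound; auto). auto.
Qed.

Lemma pow6 n : n < 6 ^ n.
Proof. apply Nat.pow_gt_lin_r. lia. Qed.

Lemma block_rank_le k m x y : k <= m -> x < 6 ^ k -> y < 6 ^ k ->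
  block_rank m x y = block_rank k x y.
Proof.
  induction 1 as [|m L IH]; auto; intros Hx Hy. rewrite <- IH by auto. apply block_rank_S.
  all: eapply Nat.lt_le_trans; [eassumption|apply Nat.pow_le_mono_r; lia].
Qed.

(** The number [x + y] of levels is large enough, since [6 ^ (x + y)] exceeds both coordinates. *)
Definition block x y := fst (block_rank (x + y) x y).
Definition rank x y := snd (block_rank (x + y) x y).
Lemma block_rank_eq x y : block_rank (x + y) x y =
  (child (block (x / 6) (y / 6)) (x mod 6) (y mod 6),
   36 * rank (x / 6) (y / 6) + order (orient (block (x / 6) (y / 6))) (x mod 6) (y mod 6)).
Proof.
  pose proof (pow6 (x + y)). 
  (* An additional level exposes the last base 6 digits. *)
  rewrite <- block_rank_S by lia. cbn [block_rank]. unfold block, rank.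
  assert (x / 6 <= x) by (apply Nat.Div0.div_le_upper_bound; lia).
  assert (y / 6 <= y) by (apply Nat.Div0.div_le_upper_bound; lia).
  pose proof (pow6 (x / 6 + y / 6)).
  rewrite (block_rank_le (x / 6 + y / 6) (x + y)) by lia.
  destruct (block_rank (x / 6 + y / 6) (x / 6) (y / 6)); auto.
Qed.

Lemma block_eq x y : block x y = child (block (x / 6) (y / 6)) (x mod 6) (y mod 6).
Proof. unfold block at 1. rewrite block_rank_eq. auto. Qed.

Lemma rank_eq x y : rank x y = 36 * rank (x / 6) (y / 6) + order (orient (block (x / 6) (y /
  6))) (x mod 6) (y mod 6).
Proof. unfold rank at 1. rewrite block_rank_eq. auto. Qed.

(** Induction on the scale: each step drops the last base 6 digit of both coordinates. The origin,
    which this leaves fixed, is the base case. *)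
Lemma base6_ind (P : nat -> nat -> Prop) : P 0 0 ->
  (forall x y, 0 < x \/ 0 < y -> P (x / 6) (y / 6) -> P x y) -> forall x y, P x y.
Proof.
  intros P0 PS. assert (H : forall n x y, x + y <= n -> P x y).
  { induction n; intros x y L.
    - replace x with 0 by lia. replace y with 0 by lia. auto.
    - destruct (Nat.eq_dec (x + y) 0).
      { replace x with 0 by lia. replace y with 0 by lia. auto. }
      apply PS; [lia|]. apply IHn.
      pose proof (Nat.div_mod_eq x 6). pose proof (Nat.div_mod_eq y 6). lia. }
  intros; eapply H; eauto.
Qed.

Lemma succ_div x : (x mod 6 < 5 /\ (x + 1) / 6 = x / 6 /\ (x + 1) mod 6 = x mod 6 + 1) \/
  (x mod 6 = 5 /\ (x + 1) / 6 = x / 6 + 1 /\ (x + 1) mod 6 = 0).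
Proof.
  pose proof (Nat.div_mod_eq x 6). pose proof (Nat.mod_upper_bound x 6).
  destruct (Nat.eq_dec (x mod 6) 5) as [e|e]; [right|left]; split; auto; try lia.
  - split; [symmetry; apply (Nat.div_unique _ 6 _ 0)|symmetry;
    apply (Nat.mod_unique _ 6 (x / 6 + 1))]; lia.
  - split; [symmetry; apply (Nat.div_unique _ 6 _ (x mod 6 + 1))|symmetry;
    apply (Nat.mod_unique _ 6 (x / 6))]; lia.
Qed.

Lemma mod6 x : x mod 6 < 6.
Proof. apply Nat.mod_upper_bound; lia. Qed.

Lemma adjacent_E x y : side E (block x y) = side W (block (x + 1) y).
Proof.
  revert x y. apply (base6_ind (fun x y => side E (block x y) = side W (block (x + 1) y))).
  - reflexivity.
  - intros x y _ IH. rewrite (block_eq x), (block_eq (x + 1)).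
    destruct (succ_div x) as [(L & -> & ->)|(-> & -> & ->)].
    + apply side_E_W; auto.
    + rewrite side_E_child, side_W_child, IH. auto.
Qed.

Lemma adjacent_N x y : side N (block x y) = side S (block x (y + 1)).
Proof.
  revert x y. apply (base6_ind (fun x y => side N (block x y) = side S (block x (y + 1)))).
  - reflexivity.
  - intros x y _ IH. rewrite (block_eq x y), (block_eq x (y + 1)).
    destruct (succ_div y) as [(L & -> & ->)|(-> & -> & ->)].
    + apply side_N_S; auto.
    + rewrite side_N_child, side_S_child, IH. auto.
Qed.

Lemma boundary_W y : side W (block 0 y) = None.
Proof.
  induction y as [y IH] using (well_founded_induction lt_wf).
  destruct (Nat.eq_dec y 0) as [->|n]; [reflexivity|].
  rewrite block_eq. change (0 / 6) with 0. change (0 mod 6) with 0.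
  rewrite side_W_child, IH; auto. apply Nat.div_lt; lia.
Qed.

Lemma boundary_S x : side S (block x 0) = None.
Proof.
  induction x as [x IH] using (well_founded_induction lt_wf).
  destruct (Nat.eq_dec x 0) as [->|n]; [reflexivity|].
  rewrite block_eq. change (0 / 6) with 0. change (0 mod 6) with 0.
  rewrite side_S_child, IH; auto. apply Nat.div_lt; lia.
Qed.

Lemma block_root x y : orient (block x y) = Root -> x = 0 /\ y = 0.
Proof.
  revert x y. apply (base6_ind (fun x y => orient (block x y) = Root -> x = 0 /\ y = 0)); auto.
  intros x y _ IH H. rewrite block_eq, orient_child in H.
  apply layout_root in H as (H & Hx & Hy); auto using mod6. apply IH in H.
  pose proof (Nat.div_mod_eq x 6). pose proof (Nat.div_mod_eq y 6). lia.
Qed.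

(** * The fractal as the set of cells outside the holes *)

Lemma in23_hole i j : (in23 i && in23 j)%bool = hole i j.
Proof. destruct i as [|[|[|[|i]]]], j as [|[|[|[|j]]]]; reflexivity. Qed.

Lemma in_K i j : In (i, j) K <-> i < 6 /\ j < 6 /\ hole i j = false.
Proof.
  unfold K. rewrite filter_In, in_prod_iff, !in_seq. cbn [fst snd].
  rewrite in23_hole, negb_true_iff. intuition lia.
Qed.

Lemma sigma_K X x y : sigma K X (x, y) <-> X (x / 6, y / 6) /\ hole (x mod 6) (y mod 6) = false.
Proof.
  unfold sigma. change (gw K) with 6. change (gh K) with 6. cbn [fst snd]. rewrite in_K.
  pose proof (mod6 x). pose proof (mod6 y). tauto.
Qed.

Lemma block_hole x y : orient (block x y) = Hole <-> orient (block (x / 6) (y / 6)) = Hole \/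
  hole (x mod 6) (y mod 6) = true.
Proof. rewrite block_eq, orient_child. apply layout_hole; apply mod6. Qed.

(** Both sides obey the same recursion: the block one scale up must belong, and the last pair of
    digits must avoid the central square. *)
Lemma Ginf_K x y : Ginf K (x, y) <-> orient (block x y) <> Hole.
Proof.
  split.
  - intros [k Hk]. revert x y Hk. induction k as [|k IH]; intros x y Hk.
    + injection Hk as -> ->. discriminate.
    + change (sigma K (Gpow K k) (x, y)) in Hk. apply sigma_K in Hk as [H1 H2].
      apply IH in H1. rewrite block_hole, H2. intuition discriminate.
  - revert x y. apply (base6_ind (fun x y => orient (block x y) <> Hole -> Ginf K (x, y))).
    + exists 0. reflexivity.
    + intros x y _ IH H. rewrite block_hole in H. destruct IH as [k Hk]; [tauto|].
      exists (Datatypes.S k). change (sigma K (Gpow K k) (x, y)). apply sigma_K.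
      split; auto. apply not_true_is_false. tauto.
Qed.

(* Cells outside the quadrant get the state of a cell deep inside a hole, which is reachable. *)
Definition void := hole_child root 2 2.
Local Open Scope Z_scope.
Definition state_at (z : pos) : state :=
  if (0 <=? fst z) && (0 <=? snd z) then block (Z.to_nat (fst z)) (Z.to_nat (snd z)) else void.
Definition height (z : pos) : nat := rank (Z.to_nat (fst z)) (Z.to_nat (snd z)).
Lemma state_at_nat x y : state_at (Z.of_nat x, Z.of_nat y) = block x y.
Proof.
  unfold state_at; cbn [fst snd]. rewrite !Nat2Z.id.
  destruct (Z.leb_spec 0 (Z.of_nat x)); [|lia]. destruct (Z.leb_spec 0 (Z.of_nat y)); [|lia].
  auto.
Qed.

Lemma height_nat x y : height (Z.of_nat x, Z.of_nat y) = rank x y.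
Proof. unfold height; cbn [fst snd]. rewrite !Nat2Z.id. auto. Qed.

Lemma state_at_cases z : (exists x y, z = (Z.of_nat x, Z.of_nat y)) \/ ((fst z < 0 \/ snd z < 0)
  /\ state_at z = void).
Proof.
  destruct z as [x y]. unfold state_at; cbn [fst snd].
  destruct (Z.leb_spec 0 x), (Z.leb_spec 0 y); cbn [andb].
  - left. exists (Z.to_nat x), (Z.to_nat y). rewrite !Z2Nat.id by auto. auto.
  - right; split; auto.
  - right; split; auto.
  - right; split; auto.
Qed.

Lemma Kinf_state_at z : Kinf_Z z <-> orient (state_at z) <> Hole.
Proof.
  split.
  - intros (x & y & -> & H). rewrite state_at_nat. apply Ginf_K; auto.
  - intro H. destruct (state_at_cases z) as [(x & y & ->)|[_ e]].
    + exists x, y. rewrite state_at_nat in H. split; auto. apply Ginf_K; auto.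
    + rewrite e in H. exfalso; apply H; reflexivity.
Qed.

Lemma shift_opp z d : shift (shift z d) (dopp d) = z.
Proof. destruct z, d; unfold shift; cbn; f_equal; lia. Qed.

Lemma dopp_dopp d : dopp (dopp d) = d.
Proof. destruct d; auto. Qed.

Lemma adjacent_EN z d : d = E \/ d = N ->
  side d (state_at z) = side (dopp d) (state_at (shift z d)).
Proof.
  destruct (state_at_cases z) as [(x & y & ->)|[L e]]; intros [-> | ->]; cbn [dopp].
  - replace (shift _ E) with (Z.of_nat (x + 1), Z.of_nat y) by (unfold shift;
    cbn [fst snd dvec]; f_equal; lia).
    rewrite !state_at_nat. apply adjacent_E.
  - replace (shift _ N) with (Z.of_nat x, Z.of_nat (y + 1)) by (unfold shift;
    cbn [fst snd dvec]; f_equal; lia).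
    rewrite !state_at_nat. apply adjacent_N.
  - rewrite e. destruct (state_at_cases (shift z E)) as [(x & y & e')|[_ ->]]; auto.
    rewrite e', state_at_nat. destruct z as [x0 y0]; unfold shift in e'; cbn in *;
      injection e' as H1 H2.
    (* A step to the east enters the quadrant only in column 0, whose W sides are empty. *)
    replace x with 0%nat by lia. rewrite boundary_W. auto.
  - rewrite e. destruct (state_at_cases (shift z N)) as [(x & y & e')|[_ ->]]; auto.
    rewrite e', state_at_nat. destruct z as [x0 y0]; unfold shift in e'; cbn in *;
      injection e' as H1 H2.
    replace y with 0%nat by lia. rewrite boundary_S. auto.
Qed.

Lemma adjacent z d : side d (state_at z) = side (dopp d) (state_at (shift z d)).
Proof.
  destruct (classic (d = E \/ d = N)) as [H|H].
  - apply adjacent_EN; auto.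
  - rewrite (adjacent_EN (shift z d) (dopp d)); [rewrite shift_opp, dopp_dopp; auto|].
  destruct d; cbn; tauto.
Qed.

Lemma state_at_root z : orient (state_at z) = Root -> z = (0, 0).
Proof.
  destruct (state_at_cases z) as [(x & y & ->)|[_ ->]]; [|discriminate].
  rewrite state_at_nat. intros [-> ->]%block_root. auto.
Qed.

(** * Inputs come from cells of smaller height *)

Definition feeds z d := orient (state_at (shift z d)) <> Hole /\
  (height (shift z d) < height z)%nat.
Lemma layout_margin o i j : (i < 6)%nat -> (j < 6)%nat ->
  i = 0%nat \/ i = 5%nat \/ j = 0%nat \/ j = 5%nat ->
  o <> Hole -> layout o i j <> Hole.
Proof.
  intros Hi Hj H Ho. rewrite layout_hole by auto. intros [|e]; auto.
  destruct H as [-> | [-> | [-> | ->]]]; [| |destruct i as [|[|[|[|i]]]]|destruct i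
    as [|[|[|[|i]]]]]; discriminate.
Qed.

Lemma feeds_nat x y d x' y' : shift (Z.of_nat x, Z.of_nat y) d = (Z.of_nat x', Z.of_nat y') ->
  feeds (Z.of_nat x, Z.of_nat y) d <-> orient (block x' y') <> Hole /\
    (rank x' y' < rank x y)%nat.
Proof. intro H. unfold feeds. rewrite H, state_at_nat, !height_nat. tauto. Qed.

Lemma feeds_same_block x y x' y' d :
  (x' / 6 = x / 6)%nat -> (y' / 6 = y / 6)%nat ->
    shift (Z.of_nat x, Z.of_nat y) d = (Z.of_nat x', Z.of_nat y') ->
  before (orient (block (x / 6) (y / 6))) (x mod 6) (y mod 6) (x' mod 6) (y' mod 6) = true ->
  feeds (Z.of_nat x, Z.of_nat y) d.
Proof.
  intros ex ey Sh B. apply (feeds_nat _ _ _ x' y' Sh).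
  rewrite (block_eq x'), (rank_eq x'), (rank_eq x), ex, ey, orient_child.
  unfold before in B. apply andb_true_iff in B as [B1 B2]. apply Nat.ltb_lt in B2.
  rewrite <- is_hole_eq. split; [|lia]. destruct (is_hole _); [discriminate|congruence].
Qed.

(** A smaller rank of the larger block outweighs any order inside it, as orders are below 36. The
    neighbour lies on the margin of its block, where a block that is not a hole has no hole. *)
Lemma feeds_next_block x y x' y' d :
  shift (Z.of_nat (x / 6), Z.of_nat (y / 6)) d = (Z.of_nat (x' / 6), Z.of_nat (y' / 6)) ->
  shift (Z.of_nat x, Z.of_nat y) d = (Z.of_nat x', Z.of_nat y') ->
  (x' mod 6 = 0 \/ x' mod 6 = 5 \/ y' mod 6 = 0 \/ y' mod 6 = 5)%nat ->
  feeds (Z.of_nat (x / 6), Z.of_nat (y / 6)) d -> feeds (Z.of_nat x, Z.of_nat y) d.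
Proof.
  intros Sh' Sh M F. apply (feeds_nat _ _ _ _ _ Sh') in F as [F1 F2].
  apply (feeds_nat _ _ _ x' y' Sh).
  rewrite (block_eq x'), (rank_eq x'), (rank_eq x), orient_child. split.
  - apply layout_margin; auto using mod6.
  - pose proof (order_lt (orient (block (x' / 6) (y' / 6))) _ _ (mod6 x') (mod6 y')). lia.
Qed.

Lemma pred_div x : (x mod 6 <> 0 -> (x - 1) / 6 = x / 6 /\ (x - 1) mod 6 = x mod 6 - 1)%nat /\
  ((0 < x -> x mod 6 = 0 -> 0 < x / 6 /\ (x - 1) / 6 = x / 6 - 1 /\ (x - 1) mod 6 = 5))%nat.
Proof.
  pose proof (Nat.div_mod_eq x 6). pose proof (mod6 x). split; intros.
  - split; [symmetry; apply (Nat.div_unique _ 6 _ (x mod 6 - 1))|symmetry;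
    apply (Nat.mod_unique _ 6 (x / 6))]; lia.
  - repeat split; [lia|symmetry; apply (Nat.div_unique _ 6 _ 5)|symmetry;
    apply (Nat.mod_unique _ 6 (x / 6 - 1))]; lia.
Qed.

(** By [layout_input] an input comes either from an earlier child of the same block or through a
    side that feeds the block, where the induction hypothesis applies. The bounds on [x] and [y]
    ensure that the neighbour to the W or S is in the quadrant. *)
Lemma input_feeds_nat x y : forall d, input (orient (block x y)) d = true ->
  (d = W -> (0 < x)%nat) /\ (d = S -> (0 < y)%nat) /\ feeds (Z.of_nat x, Z.of_nat y) d.
Proof.
  revert x y. apply (base6_ind (fun x y => forall d, input (orient (block x y)) d = true ->
    (d = W -> (0 < x)%nat) /\ (d = S -> (0 < y)%nat) /\ feeds (Z.of_nat x, Z.of_nat y) d)).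
  - discriminate.
  - intros x y _ IH d H. rewrite block_eq, orient_child in H. apply layout_input in H;
    auto using mod6.
    destruct d; cbn [locally_fed] in H.
    + split; [discriminate|split; [discriminate|]]. destruct (succ_div y) as [(L & e & m)|(L
      & e & m)].
      * replace (_ =? 5)%nat with false in H by (symmetry; apply Nat.eqb_neq; lia).
        rewrite <- m in H. apply (feeds_same_block x y x (y + 1)); auto. unfold shift;
          cbn [fst snd dvec]; f_equal; lia.
      * rewrite L in H. apply IH in H as (_ & _ & H). apply (feeds_next_block x y x (y + 1));
        auto.
        all: unfold shift; cbn [fst snd dvec]; f_equal; lia.
    + split; [discriminate|split; [discriminate|]]. destruct (succ_div x) as [(L & e & m)|(L
      & e & m)].
      * replace (_ =? 5)%nat with false in H by (symmetry; apply Nat.eqb_neq; lia).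
        rewrite <- m in H. apply (feeds_same_block x y (x + 1) y); auto. unfold shift;
          cbn [fst snd dvec]; f_equal; lia.
      * rewrite L in H. apply IH in H as (_ & _ & H). apply (feeds_next_block x y (x + 1) y);
        auto.
        all: unfold shift; cbn [fst snd dvec]; f_equal; lia.
    + pose proof (Nat.div_mod_eq y 6). destruct (pred_div y) as [P1 P2].
    destruct (Nat.eqb_spec (y mod 6) 0) as [L|L].
      * apply IH in H as (_ & H1 & H2). specialize (H1 eq_refl). destruct P2 as (Q1 & Q2 & Q3);
        [lia|auto|].
        split; [first [discriminate|intros _; lia]|split; [first [discriminate|intros _; lia]|]].
        apply (feeds_next_block x y x (y - 1)); auto. all: unfold shift; cbn [fst snd dvec];
          f_equal; lia.
      * destruct (P1 L) as [Q1 Q2]. rewrite <- Q2 in H. split; [first [discriminate|intros _;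
        lia]|split; [first [discriminate|intros _; lia]|]].
        apply (feeds_same_block x y x (y - 1)); auto. unfold shift; cbn [fst snd dvec]; f_equal;
          lia.
    + pose proof (Nat.div_mod_eq x 6). destruct (pred_div x) as [P1 P2].
    destruct (Nat.eqb_spec (x mod 6) 0) as [L|L].
      * apply IH in H as (H1 & _ & H2). specialize (H1 eq_refl). destruct P2 as (Q1 & Q2 & Q3);
        [lia|auto|].
        split; [first [discriminate|intros _; lia]|split; [first [discriminate|intros _; lia]|]].
        apply (feeds_next_block x y (x - 1) y); auto. all: unfold shift; cbn [fst snd dvec];
          f_equal; lia.
      * destruct (P1 L) as [Q1 Q2]. rewrite <- Q2 in H. split; [first [discriminate|intros _;
        lia]|split; [first [discriminate|intros _; lia]|]].
        apply (feeds_same_block x y (x - 1) y); auto. unfold shift; cbn [fst snd dvec]; f_equal;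
          lia.
Qed.

Lemma input_feeds z d : input (orient (state_at z)) d = true -> feeds z d.
Proof.
  destruct (state_at_cases z) as [(x & y & ->)|[_ ->]]; [|destruct d; discriminate].
  rewrite state_at_nat. intro H. apply input_feeds_nat; auto.
Qed.

(** * Assembly *)

(* The last bit of a label is the strength of the glue; label 0 is the null glue. *)
Definition label c := Pos.to_nat ((if is_strong c then xI else xO) (enc_content c xH)).
Definition glue o := match o with None => O | Some c => label c end.
(** [Pos.of_nat] sends 0 to [xH], which gives the null glue strength 0. *)
Definition str (n : nat) : Z := match Pos.of_nat n with xI _ => 2 | xO _ => 1 | xH => 0 end.
Lemma label_inj c c' : label c = label c' -> c = c'.
Proof.
  unfold label. intro H. apply Pos2Nat.inj in H.
  assert (enc_content c xH = enc_content c' xH) by (destruct (is_strong c), (is_strong c');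
    congruence).
  apply enc_content_inj in H0 as []; auto.
Qed.

Lemma glue_inj o o' : glue o = glue o' -> o = o'.
Proof.
  destruct o as [c|], o' as [c'|]; cbn; auto.
  - intros ->%label_inj; auto.
  - unfold label; pose proof (Pos2Nat.is_pos ((if is_strong c then xI
    else xO) (enc_content c xH))); lia.
  - unfold label; pose proof (Pos2Nat.is_pos ((if is_strong c' then xI
    else xO) (enc_content c' xH))); lia.
Qed.

Lemma str_glue o : str (glue o) = Z.of_nat (strength o).
Proof.
  destruct o as [c|]; auto. unfold str, glue, label, strength. rewrite Pos2Nat.id.
  destruct (is_strong c); auto.
Qed.

Lemma str_nonneg n : 0 <= str n.
Proof. unfold str. destruct (Pos.of_nat n); lia. Qed.

Definition make_tile a b c e : tile := fun d => match d with N => a | E => b | S => c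
  | W => e end.
Definition tile_of s := make_tile (glue (own s N)) (glue (own s E)) (glue (own s S)) (glue (own
  s W)).
Lemma tile_of_side s d : tile_of s d = glue (own s d).
Proof. destruct d; auto. Qed.

Lemma tile_of_ext s s' : (forall d, own s d = own s' d) -> tile_of s = tile_of s'.
Proof. intro H. unfold tile_of. rewrite !H. auto. Qed.

Lemma own_cases s d c : own s d = Some c -> side d s = Some c /\
  (input (orient s) d = true \/ flow c = d).
Proof.
  unfold own. destruct (side d s) as [c'|]; [|discriminate].
  destruct (input (orient s) d) eqn:I; [intros [=->]; auto|].
  destruct (dir_eqb (flow c') d) eqn:Q; [|discriminate]. intros [= ->]. apply dir_eqb_eq in Q.
  auto.
Qed.

Lemma own_input s d : input (orient s) d = true -> own s d = side d s.
Proof. unfold own. intros ->. destruct (side d s); auto. Qed.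

Lemma own_output s d c : side d s = Some c -> flow c = d -> own s d = Some c.
Proof. unfold own. intros -> <-. unfold dir_eqb. rewrite Nat.eqb_refl. destruct (input _ _);
  auto. Qed.

Lemma shift_inv z d q : shift z d = q <-> z = shift q (dopp d).
Proof.
  split; intro H.
  - rewrite <- H, shift_opp; auto.
  - rewrite H. pose proof (shift_opp q (dopp d)) as G. rewrite dopp_dopp in G. auto.
Qed.

Lemma in_dirs d : In d dirs.
Proof. destruct d; simpl; tauto. Qed.

Lemma nodup_dirs : NoDup dirs.
Proof. repeat constructor; simpl; intuition discriminate. Qed.

(** * Cuts and the edges around a cell *)

Definition sumd (f : dir -> Z) := f N + (f E + (f S + (f W + 0))).

Definition edge_of (p : pos) (d : dir) : edge :=
  match d with N => (p, N) | E => (p, E) | S => (shift p S, N) | W => (shift p W, E) end.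
Lemma edge_of_inj p d d' : edge_of p d = edge_of p d' -> d = d'.
Proof. destruct p as [x y], d, d'; unfold edge_of, shift; cbn; intro H; auto;
  first [discriminate H|injection H; intros; lia]. Qed.

Lemma nodup_edges p l : NoDup l -> NoDup (map (edge_of p) l).
Proof.
  induction 1 as [|d l n H IH]; cbn; constructor; auto.
  rewrite in_map_iff. intros (d' & e & Hd). apply edge_of_inj in e as ->. auto.
Qed.

Lemma bond_edge str A p d : bond str A (fst (edge_of p d)) (snd (edge_of p d)) = bond str A p d.
Proof.
  destruct d; auto; unfold bond; cbn [edge_of fst snd].
  - change N with (dopp S). rewrite shift_opp. cbn [dopp].
    destruct (A (shift p S)), (A p); auto. rewrite Nat.eqb_sym.
    destruct (Nat.eqb_spec (t0 S) (t N)); congruence.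
  - change E with (dopp W). rewrite shift_opp. cbn [dopp].
    destruct (A (shift p W)), (A p); auto. rewrite Nat.eqb_sym.
    destruct (Nat.eqb_spec (t0 W) (t E)); congruence.
Qed.

Lemma cut_edge_of A P p d : dom A p -> dom A (shift p d) -> (P p <-> ~ P (shift p d)) ->
  cut_edge A P (edge_of p d).
Proof.
  intros Hp Hd HP. unfold cut_edge. destruct d; cbn [edge_of fst snd]; auto.
  - change (shift (shift p S) N) with (shift (shift p S) (dopp S)). rewrite shift_opp.
    repeat split; auto; tauto.
  - change (shift (shift p W) E) with (shift (shift p W) (dopp W)). rewrite shift_opp.
    repeat split; auto; tauto.
Qed.

Lemma shift_neq p d : shift p d <> p.
Proof. destruct p, d; unfold shift; cbn; intro H; injection H; lia. Qed.

Lemma cut_edge_singleton A p e : cut_edge A (fun q => q = p) e -> exists d, e = edge_of p d /\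
  dom A (shift p d).
Proof.
  destruct e as [q d]; unfold cut_edge; cbn [fst snd]. intros (D & Hq & Hs & HP).
  destruct (classic (q = p)) as [->|n].
  - exists d. destruct D as [-> | ->]; auto.
  - destruct (classic (shift q d = p)) as [e|n']; [|tauto].
    exists (dopp d). rewrite shift_inv in e. subst q.
    destruct D as [-> | ->]; auto.
Qed.

Section Nonnegative_bonds.
Context (str : nat -> Z) (str_nonneg : forall n, 0 <= str n) (A : assembly).
Lemma bond_nonneg z d : 0 <= bond str A z d.
Proof.
  unfold bond. destruct (A z), (A (shift z d)); try lia. destruct (Nat.eqb _ _);
    [apply str_nonneg|lia].
Qed.

Lemma edges_strength_app F G : edges_strength str A (F ++ G) = edges_strength str A F +
  edges_strength str A G.
Proof. unfold edges_strength. induction F as [|e F IH]; simpl; auto. rewrite IH. lia. Qed.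

Lemma edges_strength_nonneg F : 0 <= edges_strength str A F.
Proof. unfold edges_strength. induction F as [|e F IH]; simpl; [lia|].
pose proof (bond_nonneg (fst e) (snd e)). lia. Qed.

(** [cut_strength_ge] asks for a bound on all larger finite sets of cut edges. With nonnegative
    strengths it suffices to exhibit one set that is strong enough. *)
Lemma edges_strength_mono F : forall F', NoDup F -> incl F F' ->
  edges_strength str A F <= edges_strength str A F'.
Proof.
  induction F as [|e F IH]; intros F' ND I.
  - apply edges_strength_nonneg.
  - inversion ND as [|? ? n ND']; subst. destruct (in_split e F') as (F1 & F2 & ->); [apply I;
    simpl; auto|].
    assert (I' : incl F (F1 ++ F2)).
    { intros x Hx. assert (Hx' := I x (or_intror Hx)). rewrite in_app_iff in *. simpl in Hx'. 
      destruct Hx' as [|[->|]]; tauto. }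
    specialize (IH _ ND' I'). rewrite edges_strength_app in *.
    unfold edges_strength in *. simpl. lia.
Qed.

End Nonnegative_bonds.

Lemma edges_strength_dirs str A p l (f : dir -> bool) (g : dir -> Z) :
  (forall d, if f d then bond str A p d = g d else g d = 0) ->
  edges_strength str A (map (edge_of p) (filter f l)) = fold_right (fun d acc => g d + acc) 0 l.
Proof.
  intro H. induction l as [|d l IH]; auto. cbn [filter fold_right]. specialize (H d).
  destruct (f d); cbn [map].
  - rewrite <- IH, <- H, <- bond_edge. reflexivity.
  - rewrite IH, H. reflexivity.
Qed.

Definition update (A : assembly) (p : pos) (t : tile) : assembly :=
  fun q => if (Z.eqb (fst q) (fst p) && Z.eqb (snd q) (snd p))%bool then Some t else A q.
Lemma pos_eqb_spec (q p : pos) : reflect (q = p) (Z.eqb (fst q) (fst p) && Z.eqb (snd q) (snd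
  p))%bool.
Proof.
  destruct q as [a b], p as [c d]; cbn. destruct (Z.eqb_spec a c), (Z.eqb_spec b d); cbn;
    constructor; congruence.
Qed.

Definition present (A : assembly) z := match A z with Some _ => true | None => false end.

Definition grip (str : nat -> Z) (A : assembly) (t : tile) p d :=
  match A (shift p d) with Some u => if Nat.eqb (t d) (u (dopp d)) then str (t d) else 0
    | None => 0 end.
Lemma attached_grip str tau A B p t :
  A p = None -> (exists q, dom A q) -> (forall q, B q = update A p t q) -> stable str tau B ->
  tau <= sumd (grip str A t p).
Proof.
  intros Hp [q Hq] HB State.
  assert (Bp : B p = Some t) by (rewrite HB; unfold update; destruct (pos_eqb_spec p p);
    congruence).
  assert (Bs : forall d, B (shift p d) = A (shift p d)).
  { intro d. rewrite HB; unfold update. destruct (pos_eqb_spec (shift p d) p) as [e|]; auto.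
  apply shift_neq in e as []. }
  (* The cut that isolates the new cell is crossed only by its own edges. *)
  destruct (State (fun q => q = p)) as (F & HF & Hmin).
  - exists p. split; auto. unfold dom; congruence.
  - exists q. assert (q <> p) by (intros ->; auto). split; auto.
    unfold dom. rewrite HB; unfold update. destruct (pos_eqb_spec q p); auto; congruence.
  (* These are all edges of that cut, so they include the list [F] provided by stability. *)
  - set (F' := map (edge_of p) (filter (fun d => present A (shift p d)) dirs)).
    assert (Sum : edges_strength str B F' = sumd (grip str A t p)).
    { unfold F'. rewrite (edges_strength_dirs str B p dirs _ (grip str A t p)); auto.
      intro d. unfold present, grip, bond. rewrite Bp, Bs. destruct (A (shift p d)); auto. }
    rewrite <- Sum. apply Hmin.
    + apply nodup_edges, NoDup_filter, nodup_dirs.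
    + intros e He. apply HF, cut_edge_singleton in He as (d & -> & Hd).
      apply in_map, filter_In. split; [apply in_dirs|].
      unfold dom in Hd. rewrite Bs in Hd. unfold present. destruct (A (shift p d)); congruence.
    + intros e He. apply in_map_iff in He as (d & <- & Hd). apply filter_In in Hd as [_ Hd].
      unfold present in Hd. rewrite <- Bs in Hd. apply cut_edge_of; unfold dom.
      * congruence.
      * destruct (B (shift p d)); congruence.
      * pose proof (shift_neq p d). tauto.
Qed.

(** * The tile system and its productions *)

Section System.
Context (l : list state).
Context (root_l : In root l)
  (child_l : forall s i j, In s l -> (i < 6)%nat -> (j < 6)%nat -> In (child s i j) l)
  (check_l : all_ok l = true).
Lemma block_states x y : In (block x y) l.
Proof.
  revert x y. apply (base6_ind (fun x y => In (block x y) l)); auto.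
  intros x y _ IH. rewrite block_eq. apply child_l; auto using mod6.
Qed.

Lemma state_at_states z : In (state_at z) l.
Proof.
  destruct (state_at_cases z) as [(x & y & ->)|[_ ->]].
  - rewrite state_at_nat. apply block_states.
  (* An inner child of a hole block has four empty sides. *)
  - change void with (child (child root 2 2) 2 2). apply child_l; try lia. apply child_l; auto;
    lia.
Qed.

Definition target : assembly := fun z => if is_hole (orient (state_at z)) then None
  else Some (tile_of (state_at z)).
Definition tiles := map tile_of (filter (fun s => negb (is_hole (orient s))) l).
Definition seed : assembly := update (fun _ => None) (0, 0) (tile_of root).
Definition input_closed (A : assembly) :=
  (forall z t, A z = Some t -> target z = Some t) /\ dom A (0, 0) /\
  forall z d, dom A z -> input (orient (state_at z)) d = true -> dom A (shift z d).
Lemma target_eq z : orient (state_at z) <> Hole -> target z = Some (tile_of (state_at z)).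
Proof. rewrite <- is_hole_eq. unfold target. destruct (is_hole _); congruence. Qed.

Lemma target_inv z t : target z = Some t -> orient (state_at z) <> Hole /\
  t = tile_of (state_at z).
Proof. rewrite <- is_hole_eq. unfold target. destruct (is_hole _); [discriminate|].
intros [= <-]. split; congruence. Qed.

Lemma fed_at z : orient (state_at z) <> Hole -> z <> (0, 0) ->
  fits (orient (state_at z)) (state_at z) /\
    input_strength (orient (state_at z)) (state_at z) = 2%nat.
Proof. intros h n. apply (all_ok_spec l check_l); auto using state_at_states.
intros H%state_at_root. auto. Qed.

Lemma instrength_sumd o s : Z.of_nat (input_strength o s) = sumd (fun d => if input o d
  then Z.of_nat (strength (side d s)) else 0).
Proof. unfold input_strength, sumd. cbn [map dirs list_sum fold_right].
destruct (input o N), (input o E), (input o S), (input o W); lia. Qed.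

Lemma strength_pos c : (0 < strength (Some c))%nat.
Proof. unfold strength. destruct (is_strong c); lia. Qed.

(** The content of an input side flows out of the neighbour, which therefore exposes the same
    glue. *)
Lemma target_bond A z d : input_closed A -> dom A z -> z <> (0, 0) ->
  input (orient (state_at z)) d = true ->
  bond str A z d = Z.of_nat (strength (side d (state_at z))).
Proof.
  intros (Sub & _ & Cl) Hz n Hd. assert (Hs := Cl _ _ Hz Hd). unfold dom in Hz, Hs. unfold bond.
  destruct (A z) as [t|] eqn:Az; [|congruence]. destruct (A (shift z d)) as [u|] eqn:As;
    [|congruence].
  apply Sub, target_inv in Az as [h ->], As as [_ ->].
  destruct (fed_at z h n) as [F _]. destruct (F d Hd) as (c & Hc & Hf).
  rewrite !tile_of_side, own_input, Hc by auto.
  rewrite (own_output _ (dopp d) c); [rewrite Nat.eqb_refl; apply str_glue| |auto].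
  rewrite <- adjacent. auto.
Qed.

Lemma lowest (P : pos -> Prop) z : P z -> exists z', P z' /\ forall q, P q ->
  (height z' <= height q)%nat.
Proof.
  remember (height z) as n. revert z Heqn.
  induction n as [n IH] using (well_founded_induction lt_wf).
  intros z -> Hz. destruct (classic (exists q, P q /\ (height q < height z)%nat)) as [(q & Hq
    & L)|H].
  - eapply IH; eauto.
  - exists z. split; auto. intros q Hq. apply Nat.nlt_ge. eauto.
Qed.

Lemma input_closed_cut A P z : input_closed A -> dom A z -> P z -> ~ P (0, 0) ->
  cut_strength_ge str 2 A P.
Proof.
  intros I Hz Pz Ps. destruct (lowest (fun z => dom A z /\ P z) z) as (p & [Hp Pp] & Low); auto.
  assert (n : p <> (0, 0)) by (intros ->; auto).
  pose proof I as (Sub & _ & Cl).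
  (* The witness consists of the input edges of the lowest cell [p] on its side of the cut: their
     other ends are present and lower, hence on the opposite side. *)
  exists (map (edge_of p) (filter (input (orient (state_at p))) dirs)). split.
  - intros e He. apply in_map_iff in He as (d & <- & Hd). apply filter_In in Hd as [_ Hd].
    apply cut_edge_of; auto. split; [intros _ Q|auto].
    apply input_feeds in Hd as F. destruct F as [_ F]. specialize (Low (shift p d)).
    apply Nat.lt_nge in F. auto.
  - intros F' ND Inc _. eapply Z.le_trans; [|apply edges_strength_mono;
    [apply str_nonneg| |eassumption]].
    2: apply nodup_edges, NoDup_filter, nodup_dirs.
    rewrite (edges_strength_dirs _ _ _ dirs _ (fun d => if input (orient (state_at p)) d
      then Z.of_nat (strength (side d (state_at p))) else 0)).
    + destruct (A p) as [t|] eqn:Ap; [|contradiction]. apply Sub, target_inv in Ap as [h _].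
      destruct (fed_at p h n) as [_ G].
      change (2 <= sumd (fun d => if input (orient (state_at p)) d
        then Z.of_nat (strength (side d (state_at p))) else 0)).
      rewrite <- instrength_sumd, G. lia.
    + intro d. destruct (input _ d) eqn:Hd; auto. apply target_bond; auto.
Qed.

(** This allows the side of a cut under consideration to be the one without the origin. *)
Lemma cut_compl A P tau : cut_strength_ge str tau A (fun z => ~ P z) ->
  cut_strength_ge str tau A P.
Proof.
  assert (E : forall e, cut_edge A (fun z => ~ P z) e <-> cut_edge A P e).
  { intro e. unfold cut_edge. pose proof (classic (P (fst e))).
  pose proof (classic (P (shift (fst e) (snd e)))). tauto. }
  intros (F & H1 & H2). exists F. split.
  - intros e He. apply E; auto.
  - intros F' ND I H. apply H2; auto. intros e He. apply E; auto.
Qed.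

Lemma input_closed_stable A : input_closed A -> stable str 2 A.
Proof.
  intros I P (z & Hz & Pz) (z' & Hz' & Pz'). destruct (classic (P (0, 0))) as [H|H].
  - apply cut_compl, (input_closed_cut A _ z'); auto.
  - apply (input_closed_cut A P z); auto.
Qed.

(* A cell next to [p] that has [p] as an input would need [p] in [A], so a glue of [tile_of s] can
   only match a neighbour along an input of [s]; by strength all inputs of [s] must match. *)
Lemma grip_target A p s : In s l -> input_closed A -> A p = None ->
  2 <= sumd (grip str A (tile_of s) p) ->
  target p = Some (tile_of s) /\ forall d, input (orient (state_at p)) d = true ->
    dom A (shift p d).
Proof.
  intros Hs (Sub & Seed & Cl) Hp G.
  assert (np : p <> (0, 0)) by (intros ->; apply Seed; auto).
  set (full := fun d => if input (orient s) d then Z.of_nat (strength (side d s)) else 0).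
  assert (M : forall d, 0 < grip str A (tile_of s) p d ->
    input (orient s) d = true /\ side d (state_at p) = side d s /\ dom A (shift p d) /\
      grip str A (tile_of s) p d = full d).
  { intros d. unfold grip, dom. destruct (A (shift p d)) as [u|] eqn:Au; [|lia].
    destruct (Nat.eqb_spec (tile_of s d) (u (dopp d))) as [e|]; [|lia].
    pose proof (Sub _ _ Au) as T. apply target_inv in T as [_ ->].
    rewrite !tile_of_side in *. apply glue_inj in e. rewrite str_glue.
    destruct (own s d) as [c|] eqn:O; [|cbn; lia]. symmetry in e.
    apply own_cases in O as [O1 O2]. apply own_cases in e as [e1 e2].
    assert (F : flow c = dopp d).
    { destruct e2 as [I|]; auto. exfalso. apply Cl in I; [|unfold dom; congruence].
      rewrite shift_opp in I. apply I; auto. }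
    assert (I : input (orient s) d = true).
    { destruct O2; auto. destruct d; cbn in *; congruence. }
    intros _. rewrite adjacent. unfold full. rewrite I, O1. repeat split; auto; congruence. }
  assert (nonneg : forall d, 0 <= grip str A (tile_of s) p d).
  { intro d. unfold grip. destruct (A (shift p d)); [|lia]. destruct (Nat.eqb _ _);
    [apply str_nonneg|lia]. }
  assert (le : forall d, grip str A (tile_of s) p d <= full d).
  { intro d. pose proof (nonneg d). destruct (Z.eq_dec (grip str A (tile_of s) p d) 0) as [->|];
      [|destruct (M d) as (_ & _ & _ & e); [lia|rewrite e; apply Z.le_refl]].
    unfold full. destruct (input _ d); lia. }
  (* Holes and the root have no inputs, so their total grip would be 0. *)
  assert (h : orient s <> Hole /\ orient s <> Root).
  { split; intro e; unfold full in le; rewrite e in le; cbn in le; unfold sumd in G;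
    pose proof (le N); pose proof (le E); pose proof (le S); pose proof (le W); lia. }
  destruct h as [h r]. destruct (all_ok_spec l check_l) as [C1 C2].
  destruct (C1 s Hs h r) as [F Tot].
  (* Each grip is at most [full d], and the values of [full] add up to 2; so every bound is
     attained. *)
  assert (all : forall d, input (orient s) d = true -> 0 < grip str A (tile_of s) p d).
  { intros d Hd. assert (Q : full d <= grip str A (tile_of s) p d).
    { pose proof (instrength_sumd (orient s) s) as Q. rewrite Tot in Q.
    change (2 = sumd full) in Q. unfold sumd in *.
      pose proof (le N); pose proof (le E); pose proof (le S); pose proof (le W). destruct d;
        lia. }
    unfold full in Q. rewrite Hd in Q. destruct (F d Hd) as (c & Hc & _). rewrite Hc in Q.
    pose proof (strength_pos c). lia. }
  destruct (C2 (state_at p) s) as [ho Own]; auto using state_at_states.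
  { intro H; apply state_at_root in H; auto. }
  { intros d Hd. apply M, all; auto. }
  split.
  - rewrite target_eq by auto. f_equal. apply tile_of_ext; auto.
  (* An input side of [p] carries a content flowing in. As [s] exposes it too, it must be an input
     of [s], along which a neighbour is present. *)
  - intros d Hd. destruct (fed_at p ho np) as [Fp _]. destruct (Fp d Hd) as (c & Hc & Hf).
    pose proof (own_input _ _ Hd) as O. rewrite Own, Hc in O. apply own_cases in O as [_ [I|I]].
    + apply M, all; auto.
    + destruct d; cbn in *; congruence.
Qed.

Lemma input_closed_attach A B : input_closed A -> attach tiles str 2 A B -> input_closed B.
Proof.
  intros I (p & t & Hp & Ht & HB & State).
  apply in_map_iff in Ht as (s & <- & Hs). apply filter_In in Hs as [Hs _].
  apply attached_grip with (A := A) (p := p) (t := tile_of s) in State; auto.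
  2: exists (0, 0); apply I.
  destruct (grip_target A p s Hs I Hp State) as [Tp Cp]. destruct I as (Sub & Seed & Cl).
  assert (Ex : forall z, dom A z -> dom B z).
  { intros z. unfold dom. rewrite HB. destruct (pos_eqb_spec z p); congruence. }
  repeat split; auto.
  - intros z t. rewrite HB. destruct (pos_eqb_spec z p) as [->|]; auto. congruence.
  - intros z d Hz Hd. apply Ex. unfold dom in Hz. rewrite HB in Hz.
    destruct (pos_eqb_spec z p) as [->|]; auto.
Qed.

Lemma input_closed_seed : input_closed seed.
Proof.
  assert (T : target (0, 0) = Some (tile_of root)) by reflexivity.
  repeat split.
  - intros z t. unfold seed, update. destruct (pos_eqb_spec z (0, 0)) as [->|]; congruence.
  - discriminate.
  - intros z d. unfold dom, seed, update. destruct (pos_eqb_spec z (0, 0)) as [->|];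
    [|congruence].
    destruct d; discriminate.
Qed.

Lemma input_closed_production A : production tiles str 2 seed A -> input_closed A.
Proof.
  intros (alpha & H0 & HS & HA).
  assert (I : forall i, input_closed (alpha i)).
  { induction i as [|i IH].
    - destruct input_closed_seed as (Sub & Sd & Cl). unfold input_closed, dom in *.
    setoid_rewrite H0. auto.
    - destruct (HS i) as [H|H].
      + eapply input_closed_attach; eauto.
      + destruct IH as (Sub & Sd & Cl). unfold input_closed, dom in *. setoid_rewrite H. auto. }
  (* Each clause of [input_closed] concerns one present cell at a time and so passes from the stages
     to their union. *)
  assert (D : forall z, dom A z <-> exists i, dom (alpha i) z).
  { intro z. unfold dom. split.
    - destruct (A z) as [t|] eqn:E; [|congruence]. intros _. apply HA in E as [i Hi]. exists i.
    congruence.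
    - intros [i Hi]. destruct (alpha i z) as [t|] eqn:E; [|congruence].
      rewrite (proj2 (HA z t)); [congruence|eauto]. }
  repeat split.
  - intros z t Hz. apply HA in Hz as [i Hi]. apply (I i); auto.
  - apply D. exists 0%nat. apply I.
  - intros z d Hz Hd. apply D in Hz as [i Hi]. apply D. exists i. apply (I i); auto.
Qed.

Lemma terminal_target A z : input_closed A -> terminal tiles str 2 A -> dom target z -> dom A z.
Proof.
  intros I Term Hz. apply NNPP. intro n.
  destruct (lowest (fun z => dom target z /\ ~ dom A z) z) as (p & [Hp np] & Low); auto.
  assert (Ap : A p = None) by (unfold dom in np; destruct (A p); auto; exfalso; apply np;
    discriminate).
  destruct (target p) as [t|] eqn:Tp; [|contradiction].
  pose proof (target_inv _ _ Tp) as [h e].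
  apply (Term (update A p t)). exists p, t. repeat split; auto.
  - subst t. apply in_map, filter_In. split; [apply state_at_states|].
    rewrite <- is_hole_eq in h. destruct (is_hole _); auto.
  - apply input_closed_stable. pose proof I as (Sub & Seed & Cl).
    assert (Ex : forall z, dom A z -> dom (update A p t) z).
    { intros q. unfold dom, update. destruct (pos_eqb_spec q p); congruence. }
    repeat split; auto.
    + intros q u. unfold update. destruct (pos_eqb_spec q p) as [->|]; auto. congruence.
    + intros q d Hq Hd. apply Ex. unfold dom, update in Hq. destruct (pos_eqb_spec q p)
      as [->|]; auto.
      (* The inputs of [p] are lower cells of the target, which are present because [p] is a lowest
         missing one. *)
      apply input_feeds in Hd as [F1 F2]. apply NNPP. intro n'. apply Nat.lt_nge in F2.
      apply F2, Low. split; auto.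
      unfold dom. rewrite target_eq by auto. discriminate.
Qed.

Lemma dom_target z : dom target z <-> Kinf_Z z.
Proof.
  rewrite Kinf_state_at. unfold dom. split.
  - intros H e. apply H. unfold target. rewrite e. auto.
  - intro H. rewrite target_eq by auto. discriminate.
Qed.

Lemma self_assembles : (forall z t, seed z = Some t -> In t tiles) /\ finite_assembly seed /\
  stable str 2 seed /\ strictly_self_assembles tiles str 2 seed Kinf_Z.
Proof.
  repeat split.
  - intros z t. unfold seed, update. destruct (_ && _)%bool; [|discriminate]. intros [= <-].
    apply in_map, filter_In. auto.
  - exists [(0, 0)]. intros z. unfold dom, seed, update. destruct (pos_eqb_spec z (0, 0))
    as [->|]; [simpl; auto|congruence].
  - apply input_closed_stable, input_closed_seed.
  - intro Hz. apply dom_target. apply input_closed_production in H as (Sub & _).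
    unfold dom in *. destruct (A z) as [t|] eqn:E; [|congruence]. apply Sub in E. congruence.
  - intro Hz. apply terminal_target; auto. apply input_closed_production; auto.
  apply dom_target; auto.
Qed.

End System.

Theorem mainTheorem1 :
  exists (T : list tile) (str : nat -> Z) (seed : assembly),
    (forall z t, seed z = Some t -> In t T) /\
    finite_assembly seed /\
    stable str 2 seed /\
    strictly_self_assembles T str 2 seed Kinf_Z.
Proof.
  destruct (check_spec _ check_true) as (l & Hr & Hc & Hl).
  exists (tiles l), str, seed. apply self_assembles; auto.
Qed.
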